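(* Let $Z(\beta,N)$ be the canonical partition function, at inverse temperature $\beta$, of an interacting classical gas of $N$ particles of mass $m$ with pairwise interactions in a volume $V$. Then $$Z(\beta,N)=\frac{1}{N!}B_N(\Gamma_1,\Gamma_2,\Gamma_3,\dots,\Gamma_N),$$ where $B_N(x_1,\dots,x_N)$ is the (complete) Bell polynomial and $$\Gamma_l=\frac{l!\,V}{\lambda^3}\,b_l ,$$ with $b_l$ the expansion coefficients of the classical cluster expansion and $\lambda=h\sqrt{\beta/(2\pi m)}$ the thermal wavelength.
   Context: The Hamiltonian is $H_N=\sum_{l=1}^N\frac{P_l^2}{2m}+\sum_{j<l}U_{jl}$, where $U_{jl}$ is the interaction potential between particles $j$ and $l$, and $h$ is Planck's constant. The canonical partition function is $$Z(\beta,N)=\frac{1}{N!\,h^{3N}}\int d^{3N}p\int_{V^N}d^{3N}q\;e^{-\beta H_N}=\frac{1}{N!\,\lambda^{3N}}\int_{V^N}d^{3N}q\prod_{j<l}e^{-\beta U_{jl}} .$$ Classical cluster expansion coefficients (standard textbook definition): with $f_{ij}=e^{-\beta U_{ij}}-1$, $$b_l=\frac{1}{l!\,\lambda^{3(l-1)}\,V}\int_{V^l}d^3q_1\cdots d^3q_l\sum_{G}\ \prod_{\{i,j\}\in E(G)}f_{ij},$$ where $G$ runs over all connected simple graphs on the vertex set $\{1,\dots,l\}$ and $E(G)$ is the edge set of $G$. In particular $\Gamma_1=V/\lambda^3$ and $\Gamma_2=\lambda^{-6}\int d^3q_1\int d^3q_2\,(e^{-\beta U_{12}}-1)$. Bell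 polynomial: $$B_N(x_1,\dots,x_N)=N!\sum_{\{m_l\}}\ \prod_{l=1}^N\left(\frac{x_l}{l!}\right)^{m_l}\frac{1}{m_l!},$$ the sum running over all sequences of nonnegative integers $(m_1,\dots,m_N)$ with $\sum_{l=1}^N l\,m_l=N$. *)

(* Defs.v *)
From HB Require Import structures.
From mathcomp Require Import all_boot all_order all_algebra.
From mathcomp Require Import all_classical all_reals all_analysis.
From mathcomp Require Import measurable_realfun.

Set Implicit Arguments.
Unset Strict Implicit.
Unset Printing Implicit Defensive.

Import Order.TTheory GRing.Theory Num.Theory.

Local Open Scope ring_scope.

(* The image of m1 \x m2 under a measurable f with a measurable left inverse,
   packaged as a sigma-finite measure so that it can be iterated. *)
Section iso_product.
Local Open Scope classical_set_scope.
Local Open Scope ereal_scope.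
Context d1 d2 d (T1 : measurableType d1) (T2 : measurableType d2)
  (T : measurableType d) (R : realType).
Variables (m1 : {sigma_finite_measure set T1 -> \bar R})
  (m2 : {sigma_finite_measure set T2 -> \bar R}).
Variables (f : T1 * T2 -> T) (g : T -> T1 * T2).
Hypotheses (mf : measurable_fun setT f) (mg : measurable_fun setT g).
Hypothesis fK : cancel f g.

Definition iso_product : set T -> \bar R := pushforward (m1 \x m2) f.

Let iso_product0 : iso_product set0 = 0.
Proof. exact: measure0. Qed.

Let iso_product_ge0 A : 0 <= iso_product A.
Proof. exact: measure_ge0. Qed.

Let iso_product_sigma_additive : semi_sigma_additive iso_product.
Proof. exact: measure_semi_sigma_additive. Qed.

HB.instance Definition _ := isMeasure.Build _ _ _ iso_product
  iso_product0 iso_product_ge0 iso_product_sigma_additive.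

Let iso_product_sigma_finite : sigma_finite setT iso_product.
Proof.
have /sigma_finiteP[F [FT ndF Foo]] := sigma_finiteT m1.
have /sigma_finiteP[G [GT ndG Goo]] := sigma_finiteT m2.
exists (fun n => g @^-1` (F n `*` G n)).
  apply/esym; rewrite -subTset => t _.
  have [n _ Fn] : (\bigcup_n F n) (g t).1 by rewrite -FT.
  have [k _ Gk] : (\bigcup_n G n) (g t).2 by rewrite -GT.
  exists (maxn n k) => //; split.
    by move: Fn; exact/subsetPset/ndF/leq_maxl.
  by move: Gk; exact/subsetPset/ndG/leq_maxr.
move=> k; have [mF Fk] := Foo k; have [mG Gk] := Goo k; split.
  by rewrite -[X in measurable X]setTI; apply: mg => //; exact: measurableX.
rewrite /iso_product /pushforward -comp_preimage.
rewrite (_ : g \o f = id) ?preimage_id; last exact/funext.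
by rewrite product_measure1E// lte_mul_pinfty// ge0_fin_numE.
Qed.

HB.instance Definition _ := Measure_isSigmaFinite.Build _ _ _ iso_product
  iso_product_sigma_finite.

Definition iso_product_measure : {sigma_finite_measure set T -> \bar R} :=
  iso_product.

End iso_product.

Section power_measure.
Local Open Scope classical_set_scope.
Local Open Scope ereal_scope.
Context d (T : measurableType d) (R : realType).
Variable mu : {sigma_finite_measure set T -> \bar R}.

Definition tuple_cons n (x : T * n.-tuple T) : n.+1.-tuple T :=
  [tuple of x.1 :: x.2].

Definition tuple_uncons n (t : n.+1.-tuple T) : T * n.-tuple T :=
  (tnth t ord0, [tuple of behead t]).

Lemma measurable_tuple_cons n : measurable_fun setT (@tuple_cons n).
Proof. exact: (measurable_cons measurable_fst measurable_snd). Qed.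

Lemma measurable_tuple_uncons n : measurable_fun setT (@tuple_uncons n).
Proof.
by apply: measurable_fun_pair; [exact: measurable_tnth|exact: measurable_behead].
Qed.

Lemma tuple_consK n : cancel (@tuple_cons n) (@tuple_uncons n).
Proof.
by case=> x t; rewrite /tuple_uncons tnth0; congr (_, _); exact/val_inj.
Qed.

(* The n-fold product of mu: the unit mass at the empty tuple for n = 0, and
   then the image of mu \x mu^n under (x, t) |-> x :: t. *)
Fixpoint power_measure n : {sigma_finite_measure set (n.-tuple T) -> \bar R} :=
  match n with
  | 0%N => \d_([tuple] : 0.-tuple T)
  | n'.+1 => iso_product_measure mu (power_measure n')
               (@measurable_tuple_cons n') (@measurable_tuple_uncons n')
               (@tuple_consK n')
  end.

End power_measure.

Notation vec3 R := (3.-tuple (measurableTypeR R)).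

Definition lebesgue3 (R : realType) :
    {sigma_finite_measure set (vec3 R) -> \bar R} :=
  power_measure (@lebesgue_measure R) 3.

Definition lebesgue3n (R : realType) (n : nat) :
    {sigma_finite_measure set (n.-tuple (vec3 R)) -> \bar R} :=
  power_measure (lebesgue3 R) n.

Section classical_gas.
Local Open Scope classical_set_scope.
Context {R : realType}.
(* Potentials are valued in the extended reals so that hard cores and
   singularities (U x y = +oo, i.e. Boltzmann factor 0) are allowed. *)
Implicit Types (h m beta : R) (U : vec3 R -> vec3 R -> \bar R).
Implicit Types (V : set (vec3 R)) (n N l : nat).

Definition set_power V n : set (n.-tuple (vec3 R)) :=
  [set q | forall i, V (tnth q i)].
Arguments set_power V n : clear implicits.

Definition volume V : R := fine (lebesgue3 R V).

Definition sqr_norm (p : vec3 R) : R := \sum_(k < 3) tnth p k ^+ 2.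

Definition hamiltonian m U N (p q : N.-tuple (vec3 R)) : \bar R :=
  ((\sum_(l < N) sqr_norm (tnth p l) / (2 * m))%:E +
   \sum_(l < N) \sum_(j < N | (j < l)%N) U (tnth q j) (tnth q l))%E.

Definition partition_function h m beta U V N : \bar R :=
  (((N`!)%:R * h ^+ (3 * N))^-1%:E *
   \int[lebesgue3n R N]_p \int[lebesgue3n R N]_(q in set_power V N)
     expeR (- (beta%:E * hamiltonian m U p q)))%E.

Definition thermal_wavelength h m beta : R :=
  h * Num.sqrt (beta / (2 * pi * m)).

Definition mayer beta U (x y : vec3 R) : R :=
  fine (expeR (- (beta%:E * U x y))) - 1.

End classical_gas.
Arguments set_power {R} V n.

(* A graph on 'I_l is given by its set E of edges, which are vertex pairs. *)
Definition simple_graph l (E : {set {set 'I_l}}) : bool :=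
  [forall e in E, #|e| == 2%N].

Definition connected_graph l (E : {set {set 'I_l}}) : bool :=
  [forall i : 'I_l, forall j : 'I_l,
     connect (fun u v : 'I_l => [set u; v]%SET \in E) i j].

Section cluster_expansion.
Local Open Scope classical_set_scope.
Context {R : realType}.
Implicit Types (h m beta : R) (U : vec3 R -> vec3 R -> \bar R).
Implicit Types (V : set (vec3 R)) (N l : nat).

(* For symmetric U each edge {i, j} contributes mayer beta U q_i q_j once; it
   is listed with i < j. *)
Definition cluster_integrand beta U l (q : l.-tuple (vec3 R)) : R :=
  \sum_(E : {set {set 'I_l}} | simple_graph E && connected_graph E)
    \prod_(i < l) \prod_(j < l | (i < j)%N && ([set i; j]%SET \in E))
      mayer beta U (tnth q i) (tnth q j).

(* Meaningful for 0 < l only. *)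
Definition cluster_coef h m beta U V l : R :=
  ((l`!)%:R * thermal_wavelength h m beta ^+ (3 * l.-1) * volume V)^-1 *
  \int[lebesgue3n R l]_(q in set_power V l) cluster_integrand beta U q.

Definition cluster_gamma h m beta U V l : R :=
  (l`!)%:R * volume V / thermal_wavelength h m beta ^+ 3 *
  cluster_coef h m beta U V l.

End cluster_expansion.

(* B_N(x_1, ..., x_N).  The index i : 'I_N stands for l = i.+1, and since
   l * m_l <= N every multiplicity fits in 'I_N.+1. *)
Definition bell (R : realType) (N : nat) (x : nat -> R) : R :=
  (N`!)%:R *
  \sum_(m : {ffun 'I_N -> 'I_N.+1} | (\sum_(i < N) i.+1 * m i)%N == N)
    \prod_(i < N) ((x i.+1 / (i.+1`!)%:R) ^+ m i / ((m i)`!)%:R).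

(* Main.v *)
(* Expanding prod_(i<j) (1 + f_ij) over graphs and sorting the graphs by the
   component S of a vertex i gives, with W the Boltzmann factor and c the sum
   over connected graphs, W(q) = sum_(S containing i) c(q_S) W(q_(~S)).  Summing
   over i makes the right-hand side symmetric,
     n W(q) = sum_S |S| c(q_S) W(q_(~S)),
   and by Fubini the integrals Q_n of W and I_l of c over powers of V satisfy
     n Q_n = sum_l 'C(n, l) l I_l Q_(n - l);
   the same induction yields the integrability of W.  Up to the factor
   n! lambda^(3n) this is the recursion obeyed by the coefficients of
   exp(sum_l x_l X^l / l!), which are the Bell polynomials.  The momenta only
   contribute Gaussian integrals, i.e. the powers of lambda. *)

Require Import Defs.
From mathcomp Require Import all_boot all_order all_algebra.
From mathcomp Require Import all_classical all_reals all_analysis.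
From mathcomp Require Import measurable_realfun ring.

Set Implicit Arguments.
Unset Strict Implicit.
Unset Printing Implicit Defensive.

Import Order.TTheory GRing.Theory Num.Theory.

Local Open Scope ring_scope.

(** * Graphs sorted by the component of a vertex *)

Section graph_sums.
(* classical_sets shadows setUC, subsetP, ... *)
Import mathcomp.boot.fintype mathcomp.boot.finset.

Lemma prod1D_subset (R : comPzRingType) (J : finType) (D : {set J}) (g : J -> R) :
  \prod_(e in D) (1 + g e) =
  \sum_(E : {set J} | E \subset D) \prod_(e in E) g e.
Proof.
rewrite big_mkcond /=.
(* Outside [D] the weight is set to 0, so that in the expansion over all subsets of [J] those not
   contained in [D] drop out. *)
rewrite (eq_bigr (fun e => (if e \in D then g e else 0) + 1)); last first.
  by move=> e _; case: ifP; rewrite ?add0r 1?addrC.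
rewrite bigA_distr [RHS]big_mkcond /=; apply: eq_bigr => E _.
case: ifPn => [/subsetP sED|/subsetPn[e eE eD]].
  rewrite [RHS]big_mkcond; apply: eq_bigr => e _.
  by case: ifPn => // /sED ->.
by rewrite (bigD1 e) //= eE (negbTE eD) mul0r.
Qed.

Section graphs.
Variable I : finType.
Implicit Types (E : {set {set I}}) (S : {set I}).

Definition adjacent E : rel I := fun u v => [set u; v]%SET \in E.

Definition component E (i : I) : {set I} := [set v | connect (adjacent E) i v]%SET.

Definition edges S : {set {set I}} :=
  [set e : {set I} | (#|e| == 2%N) && (e \subset S)]%SET.

Lemma mem_component E i : i \in component E i.
Proof. by rewrite inE connect0. Qed.

Lemma adjacent_sym E : symmetric (adjacent E).
Proof. by move=> u v; rewrite /adjacent setUC. Qed.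

Lemma component_closed E i u v : [set u; v]%SET \in E ->
  (u \in component E i) = (v \in component E i).
Proof.
move=> Euv; rewrite !inE; apply/idP/idP => h; apply: connect_trans h _;
  apply: connect1 => //.
by rewrite adjacent_sym.
Qed.

(** An edge has two elements, so it cannot lie both in [S] and in its complement; without the
    cardinality condition the empty set would. *)
Lemma disjoint_edges S : [disjoint edges S & edges (~: S)%SET].
Proof.
apply/pred0P => e /=; apply/negP; rewrite !inE.
move=> /andP[/andP[/eqP e2 eS] /andP[_ eSC]].
have : e \subset (S :&: ~: S)%SET by rewrite subsetI eS.
by rewrite setICr subset0 => /eqP e0; rewrite e0 cards0 in e2.
Qed.

(** A path that starts in [S] never leaves it: no edge of [E2] meets [S], and the edges of [E1] have
    both ends in [S]. *)
Lemma component_setU S E1 E2 i : i \in S ->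
  E1 \subset edges S -> E2 \subset edges (~: S)%SET ->
  component (E1 :|: E2)%SET i = component E1 i.
Proof.
move=> iS /subsetP s1 /subsetP s2; apply/setP => v; rewrite !inE.
apply/idP/idP; last first.
  apply: connect_sub => x y; rewrite /adjacent => xy.
  by apply: connect1; rewrite in_setU xy.
move=> /connectP[p ep ->] {v}; elim: p i iS ep => [|y p IH] x xS /=.
  by rewrite connect0.
move=> /andP[]; rewrite {1}/adjacent inE => /orP[xy|/s2]; last first.
  rewrite inE => /andP[_ /subsetP/(_ x)].
  by rewrite !inE eqxx xS => /(_ isT).
have yS : y \in S.
  move/s1: (xy); rewrite inE => /andP[_ /subsetP]; apply.
  by rewrite !inE eqxx orbT.
by move=> /(IH _ yS); apply: connect_trans; apply: connect1.
Qed.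

(** No edge joins a component to its complement, since [component_closed] puts both ends on the same
    side. *)
Lemma edges_component E i : E \subset edges [set: I]%SET ->
  E = ((E :&: edges (component E i)) :|:
       (E :&: edges (~: component E i)))%SET.
Proof.
move=> /subsetP sE; apply/setP => e; rewrite in_setU !in_setI -andb_orr.
case: (boolP (e \in E)) => //= eE; apply/esym.
have := sE _ eE; rewrite inE subsetT andbT => e2.
have /cards2P[u [v [_ ee]]] := e2.
rewrite !inE e2 /= ee !subUset !sub1set !in_setC.
rewrite ee in eE; rewrite (component_closed i eE).
by case: (v \in _).
Qed.

(** A graph in which [i] has component [S] amounts to a graph on [S] in which [i] reaches all of
    [S], paired with an arbitrary graph on the complement. The bijection is union, inverted by
    intersecting with the two sets of edges; the weights multiply because the two parts are
    disjoint. *)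
Lemma sum_by_component (R : comPzRingType) (w : {set I} -> R) (i : I) :
  \sum_(E : {set {set I}} | E \subset edges [set: I]%SET) \prod_(e in E) w e =
  \sum_(S : {set I} | i \in S)
    (\sum_(E : {set {set I}} | (E \subset edges S) && (component E i == S))
       \prod_(e in E) w e) *
    (\sum_(E : {set {set I}} | E \subset edges (~: S)%SET) \prod_(e in E) w e).
Proof.
rewrite (partition_big (component^~ i) (fun S => i \in S)) /=; last first.
  by move=> E _; rewrite mem_component.
apply: eq_bigr => S iS; rewrite big_distrlr /= pair_big /=.
rewrite (reindex_onto (fun p => p.1 :|: p.2)%SET
   (fun E => (E :&: edges S, E :&: edges (~: S))%SET)) /=; last first.
  by move=> E /andP[sE /eqP <-]; rewrite -edges_component.
apply: eq_big => [[E1 E2]|[E1 E2]] /=.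
  apply/idP/idP.
    move=> /andP[/andP[_ /eqP cE] /eqP[e1 e2]].
    have s1 : E1 \subset edges S by rewrite -e1 subsetIr.
    have s2 : E2 \subset edges (~: S)%SET by rewrite -e2 subsetIr.
    by rewrite s1 s2 -(component_setU iS s1 s2) cE eqxx.
  move=> /andP[/andP[s1 /eqP c1] s2].
  rewrite (component_setU iS s1 s2) c1 eqxx andbT.
  have sT A : edges A \subset edges [set: I]%SET.
    by apply/subsetP => e; rewrite !inE subsetT => /andP[->].
  rewrite subUset (subset_trans s1 (sT _)) (subset_trans s2 (sT _)) /=.
  rewrite !setIUl (setIidPl s1) (setIidPl s2).
  have dS := disjoint_edges S.
  have -> : (E2 :&: edges S = set0)%SET.
    apply/eqP; rewrite setI_eq0; apply: disjointWl s2 _.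
    by rewrite disjoint_sym.
  have -> : (E1 :&: edges (~: S) = set0)%SET.
    by apply/eqP; rewrite setI_eq0; apply: disjointWl s1 _.
  by rewrite setU0 set0U.
move=> /andP[_ /eqP[e1 e2]].
have s1 : E1 \subset edges S by rewrite -e1 subsetIr.
have s2 : E2 \subset edges (~: S)%SET by rewrite -e2 subsetIr.
rewrite -bigU /=; last exact: disjointW s1 s2 (disjoint_edges S).
by apply: eq_bigl => e; rewrite in_setU.
Qed.

End graphs.

(** * Relabelling the vertices of a graph *)

Section transport.
Variables (J I : finType) (phi : J -> I).
Hypothesis phi_inj : injective phi.

Let image_graph (E : {set {set J}}) : {set {set I}} :=
  [set phi @: (e : {set J}) | e in E]%SET.

Lemma image_graphE E u v :
  ([set phi u; phi v]%SET \in image_graph E) = ([set u; v]%SET \in E).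
Proof.
rewrite -[RHS](mem_imset _ _ (imset_inj phi_inj)).
by rewrite imsetU1 imset_set1.
Qed.

Lemma component_image_graph E j :
  component (image_graph E) (phi j) = (phi @: component E j)%SET.
Proof.
apply/setP => v; apply/idP/imsetP => [|[u]]; rewrite inE.
  move=> /connectP[p ep ->] {v}; elim: p j ep => [|y p IH] j /=.
    by exists j => //; exact: mem_component.
  move=> /andP[jy].
  (* An edge of the image graph contains only values of [phi], so the path cannot leave the
     image. *)
  have /imsetP[z _ yz] : y \in (phi @: [set: J])%SET.
    move: (jy) => /imsetP[e _ /setP/(_ y)]; rewrite !inE eqxx orbT => /esym.
    by move=> /imsetP[z _ ->]; rewrite imset_f// inE.
  rewrite yz => /IH[u]; rewrite inE => zu ->; exists u => //.
  rewrite inE; apply: connect_trans zu; apply: connect1.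
  by rewrite /adjacent -image_graphE -yz.
move=> /connectP[p ep ->] -> {u v}; rewrite inE; elim: p j ep => [|y p IH] j /=.
  by rewrite connect0.
move=> /andP[jy /IH]; apply: connect_trans; apply: connect1.
by rewrite /adjacent image_graphE.
Qed.

(** Taking images of edges is a bijection from the graphs on [J] to those on the image of [phi]. It
    serves to renumber the vertices of a subset of ['I_n]. *)
Lemma sum_connected_image (R : comPzRingType) (w : {set I} -> R) (j : J) :
  let S := (phi @: [set: J])%SET in
  \sum_(E : {set {set I}} | (E \subset edges S) && (component E (phi j) == S))
     \prod_(e in E) w e =
  \sum_(E : {set {set J}} |
     (E \subset edges [set: J]%SET) && (component E j == [set: J]%SET))
     \prod_(e in E) w (phi @: e)%SET.
Proof.
move=> S.
have img (e : {set J}) : ((phi @: e)%SET \in edges S) = (e \in edges [set: J]%SET).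
  rewrite !inE card_imset// subsetT andbT; case: eqP => //= _.
  by rewrite imsetS// subsetT.
rewrite (reindex_onto image_graph (fun E => [set e : {set J} | (phi @: e)%SET \in E]%SET)) /=.
  have K E : [set e : {set J} | (phi @: e)%SET \in image_graph E]%SET = E.
    by apply/setP => e; rewrite inE (mem_imset _ _ (imset_inj phi_inj)).
  apply: eq_big => [E|E _].
    rewrite K eqxx andbT component_image_graph (inj_eq (imset_inj phi_inj)).
    congr (_ && _); apply/subsetP/subsetP => h e.
      by move=> eE; rewrite -img; apply: h; rewrite imset_f.
    by move=> /imsetP[e' e'E ->]; rewrite img; exact: h.
  rewrite big_imset //= => e e' _ _; exact: imset_inj.
move=> E /andP[/subsetP sE _]; apply/setP => e; apply/imsetP/idP.
  by move=> [e']; rewrite inE => ? ->.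
move=> eE; have := sE _ eE; rewrite inE => /andP[_ /subsetP eS].
have ee : e = (phi @: (phi @^-1: e))%SET.
  apply/setP => x; apply/idP/imsetP => [xe|[y]].
    have /imsetP[y _ xy] := eS _ xe.
    by exists y => //; rewrite inE -xy.
  by rewrite inE => ? ->.
by exists (phi @^-1: e)%SET => //; rewrite inE -ee.
Qed.

End transport.

(** * Cluster expansion of the Boltzmann factor *)

Section cluster_sums.
Variables (R : comPzRingType) (T : Type) (f : T -> T -> R).
Hypothesis f_sym : forall x y, f x y = f y x.

(** For [g = 1 + f] this is the Boltzmann factor. Taking a list of positions lets it be evaluated on
    any subset of the particles by enumerating the subset. *)
Fixpoint pair_prod (g : T -> T -> R) (s : seq T) : R :=
  if s is x :: s' then (\prod_(y <- s') g x y) * pair_prod g s' else 1.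

Definition cluster_sum n (t : n.-tuple T) : R :=
  \sum_(E : {set {set 'I_n}} | simple_graph E && connected_graph E)
    \prod_(i < n) \prod_(j < n | (i < j)%N && ([set i; j]%SET \in E))
      f (tnth t i) (tnth t j).

(** Only the ordered pair formed by the ends of [e] contributes, so this is the value of [f] on the
    edge, and 1 when [e] is not a pair. It turns the weight of a graph into a product over its
    edges. *)
Definition edge_weight n (q : 'I_n -> T) (e : {set 'I_n}) : R :=
  \prod_(i < n) \prod_(j < n | (i < j)%N && ([set i; j]%SET == e)) f (q i) (q j).

Lemma edge_weight2 n (q : 'I_n -> T) (i j : 'I_n) : i != j ->
  edge_weight q [set i; j]%SET = f (q i) (q j).
Proof.
wlog ij : i j / (i < j)%N => [wl ineqj|_].
  have [ij|ji|/val_inj ij] := ltngtP i j; first exact: wl.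
    by rewrite setUC wl// eq_sym.
  by rewrite ij eqxx in ineqj.
have eqE (k l : 'I_n) : (k < l)%N -> ([set k; l] == [set i; j])%SET = (k == i) && (l == j).
  move=> kl; apply/eqP/andP => [/setP h|[/eqP-> /eqP->]//].
  have := h k; have := h l; rewrite !inE !eqxx orbT /= => /esym hl /esym hk.
  case/orP: hk => /eqP hk; case/orP: hl => /eqP hl; subst => //.
  - by rewrite ltnn in kl.
  - by have := ltn_trans ij kl; rewrite ltnn.
  - by rewrite ltnn in kl.
rewrite /edge_weight (bigD1 i) //= [X in _ * X]big1 ?mulr1.
  rewrite (bigD1 j) /= ?ij ?eqxx// big1 ?mulr1// => l /andP[/andP[il]].
  by rewrite eqE// => /andP[_ ->].
move=> k ki; rewrite big_pred0// => l; apply/negP => /andP[kl].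
by rewrite eqE// (negbTE ki).
Qed.

Lemma prod_edge_weight n (q : 'I_n -> T) (E : {set {set 'I_n}}) :
  \prod_(e in E) edge_weight q e =
  \prod_(i < n) \prod_(j < n | (i < j)%N && ([set i; j]%SET \in E)) f (q i) (q j).
Proof.
rewrite /edge_weight exchange_big /=; apply: eq_bigr => i _.
under eq_bigr => e _ do rewrite big_mkcondr.
rewrite exchange_big /= [RHS]big_mkcondr /=; apply: eq_bigr => j _.
rewrite -big_mkcondr /=; case: ifPn => [ijE|ijE].
  rewrite (bigD1 [set i; j]%SET) /= ?ijE ?eqxx// big1 ?mulr1// => e.
  by rewrite [_ == e]eq_sym => /andP[/andP[_ ->]].
rewrite big_pred0// => e; apply/negP => /andP[eE /eqP ee].
by rewrite ee eE in ijE.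
Qed.

Lemma connected_component n (E : {set {set 'I_n}}) i :
  connected_graph E = (component E i == [set: 'I_n]%SET).
Proof.
apply/forallP/eqP => [h|/setP h u].
  by apply/setP => v; rewrite !inE; have /forallP := h i; apply.
apply/forallP => v; have := h v; have := h u; rewrite !inE => iu iv.
apply: connect_trans iv; rewrite (sym_connect_sym (@adjacent_sym _ E))//.
Qed.


Lemma cluster_sum_component n (t : n.-tuple T) (i : 'I_n) :
  cluster_sum t =
  \sum_(E : {set {set 'I_n}} |
     (E \subset edges [set: 'I_n]%SET) && (component E i == [set: 'I_n]%SET))
     \prod_(e in E) edge_weight (tnth t) e.
Proof.
apply: eq_big => [E|E _]; last by rewrite prod_edge_weight.
rewrite (connected_component E i); congr (_ && _).
apply/forall_inP/subsetP => h e eE; have := h e eE; rewrite inE subsetT andbT //.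
Qed.

Lemma cluster_sum_tnth n k (q : 'I_n -> T) (t : k.-tuple 'I_n) (i : 'I_n) :
  uniq t -> i \in t ->
  cluster_sum [tuple of map q t] =
  \sum_(E : {set {set 'I_n}} |
     (E \subset edges [set x in t]%SET) && (component E i == [set x in t]%SET))
     \prod_(e in E) edge_weight q e.
Proof.
move=> ut /tnthP[j ->].
have tinj : injective (tnth t) by apply/tuple_uniqP.
have -> : [set x in t]%SET = (tnth t @: [set: 'I_k])%SET.
  apply/setP => x; rewrite inE; apply/tnthP/imsetP => [[l ->]|[l _ ->]];
    by exists l.
rewrite (sum_connected_image tinj) (cluster_sum_component _ j).
apply: eq_bigr => E /andP[/subsetP sE _]; apply: eq_bigr => e /sE.
rewrite inE subsetT andbT => /cards2P[a [b [ab ->]]].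
by rewrite imsetU1 imset_set1 !edge_weight2 ?(inj_eq tinj)// !tnth_map.
Qed.

(** The pairs within [a :: r] are the pairs [{a, y}] with [y] in [r], together with the pairs within
    [r], and these two families are disjoint. *)
Lemma pair_prod_edges n (q : 'I_n -> T) (r : seq 'I_n) : uniq r ->
  pair_prod (fun x y => 1 + f x y) (map q r) =
  \prod_(e in edges [set x in r]%SET) (1 + edge_weight q e).
Proof.
elim: r => [_|a r IH /= /andP[ar ur]] /=.
  rewrite big_pred0// => e; rewrite !inE; apply/negP => /andP[e2 /subsetP h].
  suff e0 : e = finset.set0 by rewrite e0 cards0 in e2.
  by apply/setP => x; rewrite inE; apply/negP => /h; rewrite !inE.
rewrite {}IH// big_map.
have pinj : {in r &, injective (fun y => [set a; y]%SET)}.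
  move=> y z yr zr /setP/(_ y); rewrite !inE eqxx orbT => /esym/orP[]/eqP// ya.
  by rewrite -ya yr in ar.
have -> : \prod_(y <- r) (1 + f (q a) (q y)) =
    \prod_(e in [set [set a; y] | y in [set x in r]]%SET) (1 + edge_weight q e).
  rewrite big_imset /=; last by move=> y z; rewrite !inE; exact: pinj.
  rewrite big_uniq//=; apply: eq_big => [y|y yr]; first by rewrite inE.
  by rewrite edge_weight2//; apply: contraNneq ar => ->.
rewrite -bigU /=.
  apply: eq_bigl => e; rewrite !inE; apply/orP/andP.
    case=> [/imsetP[y]|/andP[e2 /subsetP es]].
      rewrite inE => yr ->; rewrite cards2 subUset !sub1set !inE eqxx yr orbT.
      by rewrite (_ : a != y)//; apply: contraNneq ar => ->.
    split=> //; apply/subsetP => x /es; rewrite !inE => ->; exact: orbT.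
  move=> [e2 /subsetP es]; have [ae|ae] := boolP (a \in e).
    left; have /cards1P[y ey] : #|(e :\ a)%SET| == 1%N.
      by rewrite (cardsD1 a) ae in e2; rewrite -eqSS -add1n.
    apply/imsetP; exists y; last by rewrite -ey setD1K.
    have : y \in (e :\ a)%SET by rewrite ey inE.
    by rewrite !inE => /andP[ya /es]; rewrite !inE (negbTE ya).
  right; rewrite e2 /=; apply/subsetP => x xe; have := es _ xe; rewrite !inE.
  by move=> /orP[/eqP xa|//]; rewrite -xa xe in ae.
apply/pred0P => e /=; apply/negP => /andP[/imsetP[y _ ->]].
by rewrite !inE subUset sub1set inE (negbTE ar) andbF.
Qed.

Lemma pair_prod_cluster_sum n (q : 'I_n -> T) :
  n%:R * pair_prod (fun x y => 1 + f x y) (map q (enum 'I_n)) =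
  \sum_(S : {set 'I_n}) #|S|%:R *
    (cluster_sum [tuple of map q (in_tuple (enum S))] *
     pair_prod (fun x y => 1 + f x y) (map q (enum (~: S)%SET))).
Proof.
have enumK (S : {set 'I_n}) : [set x in enum S]%SET = S.
  by apply/setP => x; rewrite inE mem_enum.
have step (i : 'I_n) : pair_prod (fun x y => 1 + f x y) (map q (enum 'I_n)) =
    \sum_(S : {set 'I_n} | i \in S)
      (cluster_sum [tuple of map q (in_tuple (enum S))] *
       pair_prod (fun x y => 1 + f x y) (map q (enum (~: S)%SET))).
  rewrite pair_prod_edges ?enum_uniq//.
  have -> : [set x in enum 'I_n]%SET = [set: 'I_n]%SET.
    by apply/setP => x; rewrite !inE mem_enum.
  rewrite prod1D_subset (sum_by_component _ i); apply: eq_bigr => S iS.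
  rewrite pair_prod_edges ?enum_uniq// enumK prod1D_subset.
  rewrite (@cluster_sum_tnth _ _ q (in_tuple (enum S)) i) ?enum_uniq ?mem_enum//=.
  by rewrite enumK.
(* The left-hand side of [step] does not depend on [i], so summing over [i] multiplies it by [n]; on
   the right each [S] is counted once per vertex. *)
transitivity (\sum_(i < n) pair_prod (fun x y => 1 + f x y) (map q (enum 'I_n))).
  by rewrite sumr_const card_ord mulr_natl.
under eq_bigr => i _ do rewrite (step i).
rewrite (exchange_big_dep xpredT) //=; apply: eq_bigr => S _.
by rewrite sumr_const mulr_natl.
Qed.

End cluster_sums.

End graph_sums.

(** * Recursion for Bell polynomials *)

Section bell_recursion.
Variables (R : realType) (N : nat) (z : nat -> R).

(* exp (z_(i+1) X^(i+1)) up to its N-th power *)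
Definition truncated_exp (i : nat) : {poly R} :=
  \sum_(k < N.+1) (z i.+1 ^+ k / (k`!)%:R) *: 'X^(i.+1 * k).

(** Up to order [N] this is exp(z_1 X + ... + z_N X^N). *)
Definition bell_genfun : {poly R} := \prod_(i < N) truncated_exp i.

(* The error due to the truncation has order at least N, so it does not affect
   the recursion up to index N. *)
Lemma deriv_truncated_exp (i : nat) : exists q : {poly R},
  (truncated_exp i)^`() =
  (i.+1%:R * z i.+1) *: ('X^i * truncated_exp i) - 'X^N * q.
Proof.
(* The witness comes from the top term [k = N], which has no counterpart in the derivative: its
   exponent i + (i + 1) N equals N + i (N + 1), so ['X^N] factors out. *)
exists ((i.+1%:R * z i.+1) *: ((z i.+1 ^+ N / (N`!)%:R) *: 'X^(i * N.+1))).
rewrite /truncated_exp [in LHS]big_ord_recl [in RHS]big_ord_recr /=.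
rewrite derivD muln0 expr0 derivZ derivC scaler0 add0r raddf_sum.
rewrite mulrDr scalerDr mulr_sumr scaler_sumr -addrA.
rewrite [X in _ + X](_ : _ = 0) ?addr0; last first.
  rewrite -!scalerAr !scalerA -!exprD (_ : i + i.+1 * N = N + i * N.+1)%N ?subrr//.
  by rewrite mulSn mulnS addnCA addnA.
apply: eq_bigr => k _; rewrite /bump leq0n add1n /= derivZ derivXn -scalerAr scalerA -exprD.
rewrite -scalerMnr scalerMnl; congr (_ *: 'X^_); last first.
  by rewrite mulnS mulSn addSn.
rewrite factS natrM invfM exprS -mulr_natl natrM.
have k0 : k.+1%:R != 0 :> R by rewrite pnatr_eq0.
have f0 : (k`!)%:R != 0 :> R by rewrite pnatr_eq0 -lt0n fact_gt0.
move: (k.+1%:R : R) (i.+1%:R : R) ((k`!)%:R : R) k0 f0 => a b c a0 c0.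
by field; rewrite a0 c0.
Qed.

Lemma deriv_bell_genfun : exists q : {poly R},
  bell_genfun^`() =
  \sum_(i < N) (i.+1%:R * z i.+1) *: ('X^i * bell_genfun) - 'X^N * q.
Proof.
(* The number of factors [M] is separated from the truncation order [N], which stays fixed during
   the induction. *)
suff gen M : exists q : {poly R},
    (\prod_(i < M) truncated_exp i)^`() =
    \sum_(i < M) (i.+1%:R * z i.+1) *: ('X^i * \prod_(i < M) truncated_exp i)
    - 'X^N * q by exact: gen.
elim: M => [|M [q IH]].
  by exists 0; rewrite !big_ord0 mulr0 subr0 derivC.
have [q' Eq'] := deriv_truncated_exp M.
exists (q * truncated_exp M + (\prod_(i < M) truncated_exp i) * q').
rewrite !big_ord_recr /= derivM IH Eq' mulrBl mulr_suml mulrBr.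
rewrite [X in _ = _ - X]mulrDr opprD addrACA.
congr (_ + _).
  congr (_ + _); first by apply: eq_bigr => i _; rewrite -scalerAl mulrA.
  by rewrite -scalerAr; congr (_ *: _); rewrite mulrCA.
by congr (- _ - _); [rewrite mulrA | rewrite mulrCA].
Qed.

Lemma coef_bell_genfun_rec n : (n < N)%N ->
  n.+1%:R * bell_genfun`_n.+1 =
  \sum_(i < n.+1) i.+1%:R * z i.+1 * bell_genfun`_(n - i).
Proof.
move=> nN; have [q Eq] := deriv_bell_genfun.
(* As [n < N], the error term has no coefficient at X^n; neither have the summands with [i > n]. *)
rewrite mulr_natl -coef_deriv Eq coefB coefXnM nN subr0 coef_sum.
rewrite (big_ord_widen _ (fun i => i.+1%:R * z i.+1 * bell_genfun`_(n - i)) nN).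
rewrite [RHS]big_mkcond /=; apply: eq_bigr => i _.
by rewrite coefZ coefXnM ltnS ltnNge; case: leqP => // _; rewrite mulr0.
Qed.

Lemma coef0_bell_genfun : bell_genfun`_0 = 1.
Proof.
rewrite /bell_genfun coef0_prod big1// => i _.

rewrite /truncated_exp big_ord_recl muln0 !expr0 divr1 scale1r coefD coef1 eqxx.
rewrite coef_sum big1 ?addr0// => k _; rewrite coefZ coefXn lift0 mulnS.
by rewrite addSn mulr0.
Qed.

(** Expanding the product chooses one exponent [m i] from each factor. The truncation makes these
    exponents range over ['I_N.+1], exactly as in [bell]. *)
Lemma coef_bell_genfun :
  bell_genfun`_N =
  \sum_(m : {ffun 'I_N -> 'I_N.+1} | (\sum_(i < N) i.+1 * m i)%N == N)
    \prod_(i < N) (z i.+1 ^+ m i / ((m i)`!)%:R).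
Proof.
rewrite /bell_genfun /truncated_exp bigA_distr_bigA /= coef_sum [RHS]big_mkcond.
apply: eq_bigr => m _; rewrite scaler_prod -expr_sum coefZ coefXn eq_sym.
by case: eqP; rewrite ?mulr1 ?mulr0.
Qed.

End bell_recursion.

(** The recursion is that of [coef_bell_genfun_rec] with [z l = x l / l!], and it determines each
    value from the preceding ones because [n.+1] is invertible. *)
Lemma bell_unique (R : realType) (N : nat) (x Q : nat -> R) :
  Q 0%N = 1 ->
  (forall n, (n < N)%N -> n.+1%:R * Q n.+1 =
     \sum_(i < n.+1) i.+1%:R * (x i.+1 / (i.+1`!)%:R) * Q (n - i)%N) ->
  Q N = (N`!)%:R^-1 * bell N x.
Proof.
move=> Q0 Qrec; rewrite /bell mulKf ?pnatr_eq0 -?lt0n ?fact_gt0//.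
rewrite -(coef_bell_genfun N (fun l => x l / (l`!)%:R)).
set a := bell_genfun _ _.
suff QE n : (n <= N)%N -> Q n = a`_n by rewrite QE.
elim/ltn_ind: n => -[_ _|n IH nN]; first by rewrite Q0 coef0_bell_genfun.
have n0 : n.+1%:R != 0 :> R by rewrite pnatr_eq0.
apply: (mulfI n0); rewrite Qrec// coef_bell_genfun_rec//.
apply: eq_bigr => i _; rewrite IH// ?ltnS ?leq_subr//.
by rewrite (leq_trans (leq_subr _ _))// ltnW.
Qed.

(** * Splitting a power measure along a set of coordinates *)

Section power_measure_theory.
Local Open Scope classical_set_scope.
Local Open Scope ereal_scope.
Context d (T : measurableType d) (R : realType).
Variable mu : {sigma_finite_measure set T -> \bar R}.

Lemma power_measureS n (A : set (n.+1.-tuple T)) :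
  power_measure mu n.+1 A =
  \int[mu]_x power_measure mu n [set t | A (tuple_cons (x, t))].
Proof.
rewrite /= /iso_product /pushforward /product_measure1.
by apply: eq_integral => x _ /=; rewrite xsectionE.
Qed.

Lemma measurable_tuple_cons_section n (A : set (n.+1.-tuple T)) x :
  measurable A -> measurable [set t : n.-tuple T | A (tuple_cons (x, t))].
Proof.
move=> mA; rewrite -[X in measurable X]setTI.
have mx : measurable_fun setT (fun t : n.-tuple T => tuple_cons (x, t)).
  apply: (measurableT_comp (@measurable_tuple_cons d T n)).
  exact: measurable_fun_pair.
exact: mx.
Qed.

Lemma measurable_power_measure_section n (A : set (n.+1.-tuple T)) :
  measurable A ->
  measurable_fun setT (fun x => power_measure mu n [set t | A (tuple_cons (x, t))]).
Proof.
move=> mA.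
have mC : measurable (@tuple_cons d T n @^-1` A).
  by rewrite -[X in measurable X]setTI; exact: measurable_tuple_cons.
have := measurable_fun_xsection (power_measure mu n) mC.
congr (measurable_fun _ _); apply/funext => x /=; congr (power_measure mu n _).
by rewrite xsectionE.
Qed.

(** Induction on the mask: its head decides which factor receives the first coordinate, and the
    other factor is a constant that leaves the integral. [A] and [B] are sets of sequences so that
    no cast between tuple lengths arises. *)
Lemma power_measure_mask (bs : seq bool) (A B : set (seq T)) :
  measurable [set t : (count id bs).-tuple T | A t] ->
  measurable [set t : (count negb bs).-tuple T | B t] ->
  power_measure mu (size bs)
    [set t | A (mask bs t) /\ B (mask (map negb bs) t)] =
  power_measure mu (count id bs) [set t | A t] *
  power_measure mu (count negb bs) [set t | B t].
Proof.
elim: bs A B => [|[] bs IH] A B mA mB.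
- rewrite /= !diracE.
  have memE (P : Prop) (X : set (0.-tuple T)) : (X [tuple] <-> P) ->
      ([tuple] \in X) = `[<P>].
    by move=> XP; apply/idP/asboolP; rewrite inE => /XP.
  rewrite (memE (A [::] /\ B [::]))// (memE (A [::]))// (memE (B [::]))//.
  by rewrite asbool_and -EFinM -natrM mulnb.
- rewrite [LHS](@power_measureS (size bs)) [X in _ = X * _](@power_measureS (count id bs)).
  rewrite -(ge0_integralZr mu _ (@measurable_power_measure_section (count id bs) _ mA))//.
  apply: eq_integral => x _.
  exact: (IH (fun s => A (x :: s)) B (measurable_tuple_cons_section x mA) mB).
- rewrite [LHS](@power_measureS (size bs)) [X in _ = _ * X](@power_measureS (count negb bs)).
  rewrite -(ge0_integralZl mu _ (@measurable_power_measure_section (count negb bs) _ mB))//.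
  apply: eq_integral => x _.
  exact: (IH A (fun s => B (x :: s)) mA (measurable_tuple_cons_section x mB)).
Qed.

Definition subtuple n (S : {set 'I_n}) (t : n.-tuple T) : (size (enum S)).-tuple T :=
  [tuple of map (tnth t) (in_tuple (enum S))].

Lemma measurable_subtuple n (S : {set 'I_n}) : measurable_fun setT (subtuple S).
Proof.
apply/measurable_fun_tnthP => i.
rewrite (_ : _ \o _ = fun t => tnth t (tnth (in_tuple (enum S)) i)).
  exact: measurable_tnth.
by apply/funext => t /=; rewrite tnth_map.
Qed.

Lemma subtuple_mask n (S : {set 'I_n}) (t : n.-tuple T) :
  subtuple S t = mask (map (mem S) (enum 'I_n)) t :> seq T.
Proof.
by rewrite /= {1}/enum_mem -enumT filter_mask map_mask map_tnth_enum.
Qed.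

Lemma power_measure_subtuple n (S : {set 'I_n}) A B :
  measurable A -> measurable B ->
  power_measure mu n [set t | A (subtuple S t) /\ B (subtuple (~: S)%SET t)] =
  power_measure mu (size (enum S)) A * power_measure mu (size (enum (~: S)%SET)) B.
Proof.
move=> mA mB.
have maskC (t : n.-tuple T) : subtuple (~: S)%SET t =
    mask (map negb (map (mem S) (enum 'I_n))) t :> seq T.
  rewrite subtuple_mask -map_comp; congr mask; apply: eq_map => i /=.
  by rewrite inE.
pose ext k (X : set (k.-tuple T)) : set (seq T) := [set s | exists2 t, X t & tval t = s].
have extE k (X : set (k.-tuple T)) (t : k.-tuple T) : ext k X t = X t.
  by apply/propext; split=> [[u Xu /val_inj <-]//|Xt]; exists t.
have extS k (X : set (k.-tuple T)) : [set t : k.-tuple T | ext k X t] = X.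
  by apply/seteqP; split => t /=; rewrite extE.
have cards (X : {set 'I_n}) : count id (map (mem X) (enum 'I_n)) = size (enum X).
  by rewrite count_map -size_filter enumT.
have cardsC : count negb (map (mem S) (enum 'I_n)) = size (enum (~: S)%SET).
  by rewrite -cards !count_map; apply: eq_count => i /=; rewrite inE.
have sz : size (map (mem S) (enum 'I_n)) = n by rewrite size_map size_enum_ord.
(* Naming the lengths lets the equations [sz], [cards] and [cardsC] be substituted although these
   lengths occur in types. *)
have gen bs k a b (A' B' : set (seq T)) : size bs = k -> count id bs = a ->
    count negb bs = b ->
    measurable [set t : a.-tuple T | A' t] -> measurable [set t : b.-tuple T | B' t] ->
    power_measure mu k [set t | A' (mask bs t) /\ B' (mask (map negb bs) t)] =
    power_measure mu a [set t | A' t] * power_measure mu b [set t | B' t].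
  by move=> <- <- <-; exact: power_measure_mask.
have mext k (X : set (k.-tuple T)) : measurable X ->
    measurable [set t : k.-tuple T | ext k X t] by move=> mX; rewrite extS.
have muE k (X : set (k.-tuple T)) :
    power_measure mu k [set t : k.-tuple T | ext k X t] = power_measure mu k X.
  by congr (power_measure mu k _); exact: extS.
have := gen _ _ _ _ _ _ sz (cards S) cardsC (mext _ _ mA) (mext _ _ mB).
rewrite !muE => <-; congr (power_measure mu n _).
apply/seteqP; split => t /=; rewrite -subtuple_mask -maskC !extE//.
Qed.

Local Notation split_tuple S := (fun t => (subtuple S t, subtuple (~: S)%SET t)).

Lemma measurable_split_tuple n (S : {set 'I_n}) : measurable_fun setT (split_tuple S).
Proof. by apply: measurable_fun_pair; exact: measurable_subtuple. Qed.

(** The image of the power measure agrees with the product measure on rectangles by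
    [power_measure_subtuple], hence everywhere by uniqueness of the product measure. *)
Lemma integral_split_tuple n (S : {set 'I_n})
    (H : (size (enum S)).-tuple T * (size (enum (~: S)%SET)).-tuple T -> \bar R) :
  \int[pushforward (power_measure mu n) (split_tuple S)]_z H z =
  \int[power_measure mu (size (enum S)) \x power_measure mu (size (enum (~: S)%SET))]_z H z.
Proof.
apply: eq_measure_integral => [|mphi X mX _]; first exact: measurable_split_tuple.
apply/esym.
apply: product_measure_unique => // A B mA mB.
exact: power_measure_subtuple.
Qed.

Variables (n : nat) (S : {set 'I_n}).
Variables (F : (size (enum S)).-tuple T -> R) (G : (size (enum (~: S)%SET)).-tuple T -> R).
Hypothesis F_int : (power_measure mu (size (enum S))).-integrable setT (EFin \o F).
Hypothesis G_int : (power_measure mu (size (enum (~: S)%SET))).-integrable setT (EFin \o G).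

Let mF : measurable_fun setT F.
Proof. by apply/measurable_EFinP; exact: measurable_int F_int. Qed.

Let mG : measurable_fun setT G.
Proof. by apply/measurable_EFinP; exact: measurable_int G_int. Qed.

Let H z : \bar R := (F z.1 * G z.2)%:E.

Let mH : measurable_fun setT H.
Proof.
apply/measurable_EFinP; apply: measurable_funM.
  exact: measurableT_comp.
exact: measurableT_comp.
Qed.

(** By Tonelli, the integral of |F(x) G(y)| is the product of the integrals of |F| and |G|, both
    finite. *)
Let H_int : (power_measure mu (size (enum S)) \x
  power_measure mu (size (enum (~: S)%SET))).-integrable setT H.
Proof.
apply/integrableP; split => //.
rewrite fubini_tonelli1//; last exact: measurableT_comp.
rewrite /fubini_F /H /=.
under eq_integral => x _.
  under eq_integral do rewrite normrM EFinM.
  rewrite ge0_integralZl//; last first.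
    by apply/measurable_EFinP; exact: measurableT_comp.
  over.
rewrite ge0_integralZr//.
- have [_ Foo] := integrableP _ _ _ F_int; have [_ Goo] := integrableP _ _ _ G_int.
  by rewrite lte_mul_pinfty// ?ge0_fin_numE// integral_ge0.
- by apply/measurable_EFinP; exact: measurableT_comp.
- exact: integral_ge0.
Qed.

Lemma integrable_subtuple :
  (power_measure mu n).-integrable setT
    (fun t => (F (subtuple S t) * G (subtuple (~: S)%SET t))%:E).
Proof.
have mphi := @measurable_split_tuple n S.
apply/integrableP; split; first exact: (measurableT_comp mH mphi).
have mabs : measurable_fun setT (abse \o H) by exact: measurableT_comp.
have := ge0_integral_pushforward mphi (power_measure mu n) measurableT mabs (fun _ _ => abse_ge0 _).
rewrite integral_split_tuple preimage_setT => <-.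
by have /integrableP[_] := H_int.
Qed.

Lemma integral_subtuple :
  \int[power_measure mu n]_t (F (subtuple S t) * G (subtuple (~: S)%SET t))%:E =
  \int[power_measure mu (size (enum S))]_t (F t)%:E *
  \int[power_measure mu (size (enum (~: S)%SET))]_t (G t)%:E.
Proof.
have mphi := @measurable_split_tuple n S.
have := integral_pushforward mphi mH integrable_subtuple measurableT.
rewrite integral_split_tuple preimage_setT /= => <-.
rewrite -integral12_prod_meas1// /fubini_F /H /=.
under eq_integral => x _.
  under eq_integral do rewrite EFinM.
  rewrite integralZl//; over.
have := integrable_fin_num measurableT G_int; rewrite /comp.
move=> /fineK <-; by rewrite integralZr.
Qed.

End power_measure_theory.

(** * Momentum integral *)

Section momentum.
Local Open Scope classical_set_scope.
Local Open Scope ereal_scope.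

Lemma ge0_integral_power_measureS d (T : measurableType d) (R : realType)
    (mu : {sigma_finite_measure set T -> \bar R}) n (F : n.+1.-tuple T -> \bar R) :
  measurable_fun setT F -> (forall t, 0 <= F t) ->
  \int[power_measure mu n.+1]_t F t =
  \int[mu]_x \int[power_measure mu n]_t F (tuple_cons (x, t)).
Proof.
move=> mF F0; have mc := @measurable_tuple_cons _ T n.
transitivity (\int[pushforward (mu \x power_measure mu n) (@tuple_cons _ T n)]_t F t).
  by [].
rewrite ge0_integral_pushforward// preimage_setT fubini_tonelli1//.
- exact: (measurableT_comp mF mc).
- by move=> z; exact: F0.
Qed.

Lemma integral_power_measure_prod d (T : measurableType d) (R : realType)
    (mu : {sigma_finite_measure set T -> \bar R}) (g : T -> R) (c : R) n :
  measurable_fun setT g -> (forall x, 0 <= g x)%R ->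
  \int[mu]_x (g x)%:E = c%:E ->
  \int[power_measure mu n]_t (\prod_(i < n) g (tnth t i))%:E = (c ^+ n)%:E.
Proof.
move=> mg g0 gc.
have mprod k : measurable_fun setT (fun t : k.-tuple T => (\prod_(i < k) g (tnth t i))%R).
  apply: measurable_prod => i _.
  exact: (measurableT_comp mg (measurable_tnth i)).
elim: n => [|n IH].
  under eq_integral do rewrite big_ord0.
  by rewrite integral_dirac// diracT mul1e expr0.
rewrite ge0_integral_power_measureS; first last.
- by move=> t; rewrite lee_fin prodr_ge0.
- by apply/measurable_EFinP; exact: mprod.
have consE (x : T) (t : n.-tuple T) :
    (\prod_(i < n.+1) g (tnth (tuple_cons (x, t)) i) =
     g x * \prod_(i < n) g (tnth t i))%R.
  by rewrite big_ord_recl; congr (_ * _)%R; apply: eq_bigr => i _; rewrite tnthS.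
under eq_integral => x _.
  under eq_integral do rewrite consE EFinM.
  rewrite ge0_integralZl//; first last.
  - by rewrite lee_fin.
  - by move=> t _; rewrite lee_fin prodr_ge0.
  - by apply/measurable_EFinP; exact: mprod.
  rewrite IH.
  over.
rewrite ge0_integralZr//.
- by rewrite gc -EFinM exprS.
- exact/measurable_EFinP.
- by move=> x _; rewrite lee_fin.
- by rewrite lee_fin exprn_ge0// -lee_fin -gc integral_ge0// => x _; rewrite lee_fin.
Qed.

(** The density [normal_pdf 0 s], with [s] the square root of [a], has integral 1, and the
    right-hand side is the inverse of its peak. *)
Lemma integral_gaussian (R : realType) (a : R) : (0 < a)%R ->
  \int[lebesgue_measure]_x (expR (- (x ^+ 2 / (2 * a))))%:E = (Num.sqrt (2 * pi * a))%:E.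
Proof.
move=> a0; pose s := Num.sqrt a.
have s0 : s != 0%R by rewrite gt_eqF// sqrtr_gt0.
have s2 : (s ^+ 2 = a)%R by rewrite sqr_sqrtr// ltW.
have k0 : (0 < Num.sqrt (2 * pi * a))%R by rewrite sqrtr_gt0 !mulr_gt0// pi_gt0.
transitivity (\int[lebesgue_measure]_x ((Num.sqrt (2 * pi * a))%:E * (normal_pdf 0 s x)%:E)).
  apply: eq_integral => x _; rewrite normal_pdfE// -EFinM /normal_peak /normal_fun.
  rewrite s2 subr0 mulrA (_ : a * pi *+ 2 = 2 * pi * a)%R; last first.
    by rewrite -mulr_natl -mulrA; congr (_ * _)%R; rewrite mulrC.
  rewrite divff ?gt_eqF// mul1r mulNr; congr (expR (- (_ / _)))%:E.
  by rewrite mulr_natl.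
rewrite integralZl ?integral_normal_pdf ?mule1//; exact: integrable_normal_pdf.
Qed.

(** The exponential factors over the particles and then over the three components, so
    [integral_power_measure_prod] applies twice to a Gaussian of variance m / beta. The base of the
    power is h / lambda. *)
Lemma integral_kinetic (R : realType) (m beta : R) n : (0 < m)%R -> (0 < beta)%R ->
  \int[lebesgue3n R n]_p
    (expR (- (beta * \sum_(l < n) sqr_norm (tnth p l) / (2 * m))))%:E =
  (Num.sqrt (2 * pi * (m / beta)) ^+ (3 * n))%:E.
Proof.
move=> m0 b0.
pose g1 (x : R) := expR (- (x ^+ 2 / (2 * (m / beta)))).
pose g3 (p : vec3 R) := (\prod_(k < 3) g1 (tnth p k))%R.
have expE (p : vec3 R) : expR (- (beta * (sqr_norm p / (2 * m)))) = g3 p.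
  rewrite /g3 -expR_sum; congr expR; rewrite sumrN; congr (- _)%R.
  rewrite -mulr_suml -/(sqr_norm p).
  by field; rewrite !gt_eqF.
have mg1 : measurable_fun setT g1.
  apply: measurableT_comp => //; apply: measurableT_comp => //.
  by apply: measurable_funM => //; exact: measurable_funX.
have mg3 : measurable_fun setT g3.
  apply: measurable_prod => k _.
  exact: (measurableT_comp mg1 (measurable_tnth k)).
have g10 x : (0 <= g1 x)%R by exact: expR_ge0.
have g30 p : (0 <= g3 p)%R by exact: prodr_ge0.
have e1 : \int[lebesgue_measure]_x (g1 x)%:E = (Num.sqrt (2 * pi * (m / beta)))%:E.
  by apply: integral_gaussian; rewrite divr_gt0.
have e3 : \int[lebesgue3 R]_p (g3 p)%:E = (Num.sqrt (2 * pi * (m / beta)) ^+ 3)%:E.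
  exact: (@integral_power_measure_prod _ (measurableTypeR R) R lebesgue_measure g1
    _ 3 mg1 g10 e1).
rewrite exprM -(integral_power_measure_prod n mg3 g30 e3).
apply: eq_integral => p _; congr EFin.
by rewrite mulr_sumr -sumrN expR_sum; apply: eq_bigr => l _; rewrite expE.
Qed.

End momentum.

(** * Recursion for the configuration integrals *)

Section cluster_recursion.
Import numFieldNormedType.Exports.
Local Open Scope classical_set_scope.
Variables (R : realType) (f : vec3 R -> vec3 R -> R) (V : set (vec3 R)) (N : nat).
Hypothesis f_sym : forall x y, f x y = f y x.
Hypothesis V_meas : measurable V.
Hypothesis cluster_int : forall l : nat, (0 < l <= N)%N ->
  (lebesgue3n R l).-integrable (set_power V l) (fun q => (cluster_sum f q)%:E).

Let W n (t : n.-tuple (vec3 R)) : R := pair_prod (fun x y => 1 + f x y) t.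
Let Q n : R := \int[lebesgue3n R n]_(t in set_power V n) W t.
Let I l : R := \int[lebesgue3n R l]_(t in set_power V l) cluster_sum f t.

Lemma measurable_set_power n : measurable (set_power V n).
Proof.
rewrite (_ : set_power V n = \bigcap_(i in [set: 'I_n]) ((@tnth n (vec3 R))^~ i @^-1` V)).
  apply: fin_bigcap_measurable => // i _; rewrite -[X in measurable X]setTI.
  exact: measurable_tnth.
by apply/seteqP; split => t /= h i; [move=> _|]; exact: h.
Qed.

Lemma set_power_subtuple n (S : {set 'I_n}) (t : n.-tuple (vec3 R)) :
  (t \in set_power V n) =
  (subtuple S t \in set_power V _) && (subtuple (~: S)%SET t \in set_power V _).
Proof.
have sub (X : {set 'I_n}) : (subtuple X t \in set_power V _) <->
    (forall i, i \in X -> V (tnth t i)).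
  rewrite inE; split => [h i iX|h i]; last first.
    by rewrite tnth_map; apply: h; rewrite -mem_enum; exact: mem_tnth.
  have /tnthP[j ->] : i \in in_tuple (enum X) by rewrite mem_enum.
  by have := h j; rewrite tnth_map.
apply/idP/andP => [|[/sub hS /sub hC]].
  by rewrite inE => h; split; apply/sub => i _; exact: h.
rewrite inE => i; have [iS|iS] := boolP (i \in S); first exact: hS.
by apply: hC; rewrite inE.
Qed.

(** The indicator of [set_power V n] factors along [S] and its complement, so the graph identity
    extends by zero to all tuples, where [integral_subtuple] applies. *)
Lemma pair_prod_restrict n (t : n.-tuple (vec3 R)) :
  n%:R * (@W n \_ (set_power V n)) t =
  \sum_(S : {set 'I_n}) #|S|%:R *
    ((@cluster_sum _ _ f (size (enum S)) \_ (set_power V _)) (subtuple S t) *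
     (@W (size (enum (~: S)%SET)) \_ (set_power V _)) (subtuple (~: S)%SET t)).
Proof.
rewrite !patchE; have [tV|tV] := ifPn.
  have := pair_prod_cluster_sum f_sym (tnth t); rewrite map_tnth_enum => ->.
  apply: eq_bigr => S _; rewrite !patchE.
  by move: tV; rewrite (set_power_subtuple S) => /andP[-> ->].
rewrite mulr0 big1// => S _; rewrite !patchE.
move: tV; rewrite (set_power_subtuple S) negb_and => /orP[]/negbTE ->.
  by rewrite mul0r mulr0.
by rewrite !mulr0.
Qed.

Lemma sum_card_set (n : nat) (F : nat -> R) :
  \sum_(S : {set 'I_n}) F #|S| = \sum_(k < n.+1) 'C(n, k)%:R * F k.
Proof.
rewrite (partition_big (fun S : {set 'I_n} => inord #|S| : 'I_n.+1) xpredT)//=.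
apply: eq_bigr => k _.
rewrite (eq_bigl (fun S => S \in [set A : {set 'I_n} | #|A| == k]%SET)); last first.
  move=> S; rewrite inE -val_eqE /= inordK// ltnS.
  by rewrite (leq_trans (max_card _))// card_ord.
rewrite (eq_bigr (fun=> F k)); last by move=> S; rewrite inE => /eqP ->.
by rewrite sumr_const card_draws card_ord mulr_natl.
Qed.

(** Integrability of the next [W] is a conclusion here: (n + 1) W is a finite sum of products of a
    cluster sum and a Boltzmann factor of at most [n] particles. *)
Lemma cluster_recursion_step n : (n < N)%N ->
  (forall k, (k <= n)%N ->
     (lebesgue3n R k).-integrable (set_power V k) (fun t => (@W k t)%:E)) ->
  (lebesgue3n R n.+1).-integrable (set_power V n.+1) (fun t => (@W n.+1 t)%:E) /\
  n.+1%:R * Q n.+1 = \sum_(S : {set 'I_n.+1}) #|S|%:R * (I #|S| * Q (n.+1 - #|S|)).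
Proof.
move=> nN Wint.
have mV k := measurable_set_power k.
pose h (S : {set 'I_n.+1}) (t : n.+1.-tuple (vec3 R)) : \bar R :=
  (#|S|%:R * ((@cluster_sum _ _ f (size (enum S)) \_ (set_power V _)) (subtuple S t) *
     (@W (size (enum (~: S)%SET)) \_ (set_power V _)) (subtuple (~: S)%SET t)))%:E.
have intR k (F : k.-tuple (vec3 R) -> R) :
    (lebesgue3n R k).-integrable (set_power V k) (fun t => (F t)%:E) <->
    (lebesgue3n R k).-integrable setT (EFin \o (F \_ (set_power V k))).
  by rewrite -restrict_EFin; exact: (integrable_mkcond (EFin \o F) (mV k)).
have RintE k (F : k.-tuple (vec3 R) -> R) :
    (lebesgue3n R k).-integrable (set_power V k) (fun t => (F t)%:E) ->
    (\int[lebesgue3n R k]_t ((F \_ (set_power V k)) t)%:E =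
     (\int[lebesgue3n R k]_(t in set_power V k) F t)%:E)%E.
  move=> Fint; rewrite Rintegral_mkcond /Rintegral fineK//.
  by apply: (integrable_fin_num measurableT); exact/intR.
have hint S : (lebesgue3n R n.+1).-integrable setT (h S) /\
    (\int[lebesgue3n R n.+1]_t h S t = (#|S|%:R * (I #|S| * Q (n.+1 - #|S|)))%:E)%E.
  (* For empty [S] the other factor is the Boltzmann factor of all [n.+1] particles, whose
     integrability is not yet known; the weight [#|S| = 0] removes this term. *)
  have [S0|S0] := eqVneq #|S| 0%N.
    have -> : h S = cst 0%E by apply/funext => t; rewrite /h S0 mul0r.
    by rewrite S0 mul0r integral0; split => //; exact: integrable0.
  have sS : size (enum S) = #|S| by rewrite -cardE.
  have sC : size (enum (~: S)%SET) = (n.+1 - #|S|)%N by rewrite -cardE cardsCs finset.setCK card_ord.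
  have clS : (lebesgue3n R (size (enum S))).-integrable (set_power V _)
      (fun t => (cluster_sum f t)%:E).
    apply: cluster_int; rewrite sS lt0n S0/= (leq_trans (max_card _))// card_ord//.
  have WS : (lebesgue3n R (size (enum (~: S)%SET))).-integrable (set_power V _)
      (fun t => (@W _ t)%:E).
    apply: Wint; rewrite sC leq_subLR; move: S0; case: #|S| => // k _.
    by rewrite addSn ltnS leq_addl.
  have ii := integrable_subtuple (proj1 (intR _ _) clS) (proj1 (intR _ _) WS).
  have ie := integral_subtuple (proj1 (intR _ _) clS) (proj1 (intR _ _) WS).
  have -> : h S = fun t => (#|S|%:R%:E * (((@cluster_sum _ _ f _ \_ (set_power V _)) (subtuple S t) *
     (@W _ \_ (set_power V _)) (subtuple (~: S)%SET t))%:E))%E.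
    by apply/funext => t; rewrite /h EFinM.
  split; first exact: integrableZl.
  rewrite integralZl// ie !RintE// -!EFinM -/(I _) -/(Q _).
  by rewrite sS sC.
have hsum t : (n.+1%:R * (@W n.+1 \_ (set_power V n.+1)) t)%:E = (\sum_S h S t)%E.
  by rewrite pair_prod_restrict -sumEFin.
have Wi : (lebesgue3n R n.+1).-integrable (set_power V n.+1) (fun t => (@W n.+1 t)%:E).
  apply/intR.
  rewrite (_ : _ \o _ = fun t => (n.+1%:R^-1%:E * (\sum_S h S t))%E); last first.
    by apply/funext => t; rewrite -hsum /= -EFinM mulKf// pnatr_eq0.
  apply: integrableZl => //; apply: integrable_sum => // S _.
  exact: (hint S).1.
split=> //.
apply: EFin_inj; rewrite EFinM -RintE// -integralZl//; last exact/intR.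
under eq_integral do rewrite -EFinM hsum.
rewrite integral_sum//; last by move=> S; exact: (hint S).1.
by rewrite -sumEFin; apply: eq_bigr => S _; exact: (hint S).2.
Qed.

Lemma integrable_pair_prod n : (n <= N)%N ->
  (lebesgue3n R n).-integrable (set_power V n) (fun t => (@W n t)%:E).
Proof.
elim/ltn_ind: n => -[_ _|n IH nN].
  (* Without particles the measure is a Dirac mass, hence finite, and the integrand is the constant
     1. *)
  rewrite (_ : (fun _ => _) = EFin \o cst 1); last first.
    by apply/funext => t; rewrite tuple0.
  by apply: (@finite_measure_integrable_cst _ _ _ (\d_ ([tuple] : 0.-tuple (vec3 R))));
    exact: measurable_set_power.
have [] := cluster_recursion_step nN => // k kn.
by apply: IH; rewrite ?ltnS// (leq_trans kn)// ltnW.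
Qed.

Lemma pair_prod_integral0 : Q 0 = 1.
Proof.
rewrite /Q /Rintegral integral_dirac//; last 2 first.
- exact: measurable_set_power.
- rewrite (_ : (fun _ => _) = cst 1%E); last first.
    by apply/funext => t; rewrite tuple0.
  exact: measurable_cst.
by rewrite mule1 diracE mem_set// => -[].
Qed.

Lemma cluster_recursion n : (n < N)%N ->
  n.+1%:R * Q n.+1 =
  \sum_(i < n.+1) 'C(n.+1, i.+1)%:R * (i.+1%:R * (I i.+1 * Q (n - i)%N)).
Proof.
move=> nN; have [|_ ->] := cluster_recursion_step nN.
  by move=> k kn; apply: integrable_pair_prod; rewrite (leq_trans kn)// ltnW.
rewrite (sum_card_set n.+1 (fun k => k%:R * (I k * Q (n.+1 - k)))).
rewrite big_ord_recl mul0r mulr0 add0r.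
by apply: eq_bigr => i _; rewrite lift0 subSS.
Qed.

(** Dividing [Q n] by n! lambda^(3n) turns the recursion with binomials into that of [bell_unique].
    The values of [x] are prescribed from index 1 on, since [cluster_gamma] carries no meaning at
    0. *)
Lemma pair_prod_bell (lambda : R) (x : nat -> R) : lambda != 0 ->
  (forall l, x l.+1 = I l.+1 / lambda ^+ (3 * l.+1)) ->
  Q N / ((N`!)%:R * lambda ^+ (3 * N)) = (N`!)%:R^-1 * bell N x.
Proof.
move=> l0 xE.
apply: (@bell_unique _ N x (fun n => Q n / ((n`!)%:R * lambda ^+ (3 * n)))).
  by rewrite muln0 mulr1 invr1 mulr1 pair_prod_integral0.
move=> n nN; rewrite mulrA cluster_recursion// mulr_suml.
apply: eq_bigr => i _; rewrite xE.
have iN : (i.+1 <= n.+1)%N by [].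
(* Writing (n + 1)! as a binomial times two factorials leaves an identity of rational functions. *)
have <- := bin_fact iN; rewrite subSS.
have -> : (3 * n.+1 = 3 * i.+1 + 3 * (n - i))%N.
  by rewrite -mulnDr addSn subnKC// -ltnS.
have fact0 k : (k`!)%:R != 0 :> R by rewrite pnatr_eq0 -lt0n fact_gt0.
have C0 : 'C(n.+1, i.+1)%:R != 0 :> R by rewrite pnatr_eq0 -lt0n bin_gt0.
have e0 k : lambda ^+ k != 0 by rewrite expf_neq0.
move: (i.+1)`! (n - i)`! 'C(n.+1, i.+1) (fact0 i.+1) (fact0 (n - i)%N) C0 => p q c p0 q0 c0.
rewrite exprD !natrM.
by field; rewrite p0 q0 c0 !e0.
Qed.

End cluster_recursion.

(** * The Boltzmann factor of the Hamiltonian *)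

Lemma pair_prod_tnth (R : comPzRingType) (T : Type) (g : T -> T -> R) n (t : n.-tuple T) :
  pair_prod g t = \prod_(l < n) \prod_(j < n | (j < l)%N) g (tnth t j) (tnth t l).
Proof.
elim: n t => [|n IH] t; first by rewrite tuple0 big_ord0.
case/tupleP: t => x t /=; rewrite IH [RHS]big_ord_recl [X in _ = X * _]big_pred0// mul1r.
(* [pair_prod] groups the pairs by the smaller index, the double product by the larger one: the new
   first particle adds the factor [j = 0] to every later inner product. *)
rewrite big_tuple -big_split /=; apply: eq_bigr => l _.
rewrite [RHS]big_mkcond big_ord_recl /= tnthS tnth0 -big_mkcond; congr (_ * _).
rewrite [LHS]big_mkcond [RHS]big_mkcond.
by apply: eq_bigr => j _; rewrite tnthS.
Qed.

Section boltzmann.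
Local Open Scope ereal_scope.
Variables (R : realType) (beta : R).

Lemma boltzmann_fin (x : \bar R) : (0 < beta)%R -> -oo < x ->
  expeR (- (beta%:E * x)) = (fine (expeR (- (beta%:E * x))))%:E.
Proof. by move=> b0; case: x => [r||]//= _; rewrite gt0_muley. Qed.

(** An energy [+oo] makes both sides 0. Excluding [-oo] matters, because it would absorb [+oo] in
    the sum. *)
Lemma boltzmannD (x y : \bar R) : (0 < beta)%R -> -oo < x -> -oo < y ->
  expeR (- (beta%:E * (x + y))) =
  expeR (- (beta%:E * x)) * expeR (- (beta%:E * y)).
Proof.
move=> b0; case: x => [x||]//; case: y => [y||]// _ _;
  rewrite ?addye ?addey// ?gt0_muley ?lte_fin//= ?mule0 ?mul0e//.
by rewrite -EFinM -expRD mulrDr opprD.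
Qed.

(** The lower bound is carried along because [boltzmannD] requires it of every partial sum. *)
Lemma boltzmann_sum (I : Type) (r : seq I) (P : pred I) (F : I -> \bar R) :
  (0 < beta)%R -> (forall i, P i -> -oo < F i) ->
  -oo < \sum_(i <- r | P i) F i /\
  expeR (- (beta%:E * \sum_(i <- r | P i) F i)) =
  (\prod_(i <- r | P i) fine (expeR (- (beta%:E * F i))))%:E.
Proof.
move=> b0 F0.
apply: (big_ind2 (fun x y => -oo < x /\ expeR (- (beta%:E * x)) = y%:E)).
- by rewrite mule0 oppe0 expeR0.
- move=> x1 x2 y1 y2 [x1N e1] [y1N e2]; split; last by rewrite boltzmannD// e1 e2.
  by rewrite !ltNye adde_eq_ninfty negb_or -!ltNye x1N.
- by move=> i Pi; split; [exact: F0|apply: boltzmann_fin => //; exact: F0].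
Qed.

End boltzmann.

Local Open Scope classical_set_scope.

Lemma mayer_sym (R : realType) (beta : R) (U : vec3 R -> vec3 R -> \bar R) :
  (forall x y, U x y = U y x) -> forall x y, mayer beta U x y = mayer beta U y x.
Proof. by move=> Usym x y; rewrite /mayer Usym. Qed.

Lemma expeR_hamiltonian (R : realType) (m beta : R)
    (U : vec3 R -> vec3 R -> \bar R) N (p q : N.-tuple (vec3 R)) :
  0 < beta -> (forall x y, (-oo < U x y)%E) ->
  (expeR (- (beta%:E * hamiltonian m U p q)) =
   (expR (- (beta * \sum_(l < N) sqr_norm (tnth p l) / (2 * m))))%:E *
   (pair_prod (fun x y => 1 + mayer beta U x y) q)%:E)%E.
Proof.
move=> b0 U0; rewrite /hamiltonian.
(* [boltzmann_sum] serves for the sum over [j] and then for the sum over [l]; the bound from the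
   first use is the hypothesis of the second. *)
have inner (l : 'I_N) := boltzmann_sum (index_enum _) b0
  (fun (j : 'I_N) (_ : (j < l)%N) => U0 (tnth q j) (tnth q l)).
have [outer0 outerE] := boltzmann_sum (index_enum _) b0
  (fun (l : 'I_N) (_ : true) => (inner l).1).
rewrite boltzmannD ?ltNyr// outerE; congr (_ * _)%E; congr EFin.
rewrite pair_prod_tnth; apply: eq_bigr => l _; rewrite (inner l).2 /=.
by apply: eq_bigr => j _; rewrite /mayer addrC subrK.
Qed.

(** The factorial and the volume cancel against those in [cluster_coef]. At [l.+1] the predecessor
    in the exponent computes, and the powers of lambda add up to 3 (l + 1). *)
Lemma cluster_gammaS (R : realType) (h m beta : R)
    (U : vec3 R -> vec3 R -> \bar R) (V : set (vec3 R)) (l : nat) :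
  thermal_wavelength h m beta != 0 -> volume V != 0 ->
  cluster_gamma h m beta U V l.+1 =
  (\int[lebesgue3n R l.+1]_(t in set_power V l.+1) cluster_sum (mayer beta U) t) /
  thermal_wavelength h m beta ^+ (3 * l.+1).
Proof.
move=> lam0 vol0; rewrite /cluster_gamma /cluster_coef.
rewrite (_ : \int[_]_(_ in _) cluster_integrand _ _ _ =
  \int[lebesgue3n R l.+1]_(t in set_power V l.+1) cluster_sum (mayer beta U) t)//.
move: (\int[_]_(_ in _) _) => J /=; rewrite mulnS exprD.
have f0 : (l.+1`!)%:R != 0 :> R by rewrite pnatr_eq0 -lt0n fact_gt0.
move: (l.+1`!) f0 => k k0.
by field; rewrite k0 vol0 expf_neq0// lam0.
Qed.

Theorem theorem4 (R : realType) (h m beta : R)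
    (U : vec3 R -> vec3 R -> \bar R) (V : set (vec3 R)) (N : nat)
    (h_gt0 : 0 < h) (m_gt0 : 0 < m) (beta_gt0 : 0 < beta)
    (U_sym : forall x y, U x y = U y x)
    (U_gtNy : forall x y, (-oo < U x y)%E)
    (U_meas : measurable_fun setT (fun z : vec3 R * vec3 R => U z.1 z.2))
    (V_meas : measurable V)
    (V_gt0 : (0 < lebesgue3 R V)%E) (V_lty : (lebesgue3 R V < +oo)%E)
    (cluster_integrable : forall l : nat, (0 < l <= N)%N ->
       (lebesgue3n R l).-integrable (set_power V l)
         (fun q => (cluster_integrand beta U q)%:E)) :
  partition_function h m beta U V N =
    ((N`!)%:R^-1 * bell N (cluster_gamma h m beta U V))%:E.
Proof.
pose W (q : N.-tuple (vec3 R)) := pair_prod (fun x y => 1 + mayer beta U x y) q.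
pose kin (p : N.-tuple (vec3 R)) :=
  expR (- (beta * \sum_(l < N) sqr_norm (tnth p l) / (2 * m))).
have fsym := mayer_sym beta U_sym.
have Wint : (lebesgue3n R N).-integrable (set_power V N) (fun q => (W q)%:E).
  exact: (integrable_pair_prod fsym V_meas cluster_integrable (leqnn N)).
have mVN : measurable (set_power V N) by exact: measurable_set_power.
have W0 q : 0 <= W q.
  rewrite /W pair_prod_tnth; do 2!apply: prodr_ge0 => ? _.
  by rewrite /mayer addrC subrK fine_ge0// expeR_ge0.
pose Q := \int[lebesgue3n R N]_(q in set_power V N) W q.
have QE : (\int[lebesgue3n R N]_(q in set_power V N) (W q)%:E = Q%:E)%E.
  by rewrite fineK//; exact: integrable_fin_num.
have mkin : measurable_fun setT kin.
  apply: measurableT_comp => //; apply: measurableT_comp => //.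
  apply: measurable_funM => //; apply: measurable_sum => l.
  apply: measurable_funM => //; apply: measurable_sum => k.
  apply: measurable_funX.
  exact: (measurableT_comp (measurable_tnth k) (measurable_tnth l)).
(* [s] is lambda / h, and by [sV] each one-dimensional momentum integral equals its inverse. *)
pose s := Num.sqrt (beta / (2 * pi * m)).
have s0 : 0 < s by rewrite sqrtr_gt0 divr_gt0// !mulr_gt0// pi_gt0.
have sV : Num.sqrt (2 * pi * (m / beta)) = s^-1.
  rewrite -sqrtrV; first by congr Num.sqrt; rewrite invf_div mulrA.
  by rewrite divr_ge0// ltW// !mulr_gt0// pi_gt0.
have lamE : thermal_wavelength h m beta = h * s by [].
have lam0 : thermal_wavelength h m beta != 0 by rewrite lamE gt_eqF// mulr_gt0.
have vol0 : volume V != 0 by rewrite gt_eqF// fine_gt0// V_gt0.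
rewrite /partition_function.
under eq_integral => p _.
  under eq_integral do rewrite (expeR_hamiltonian m _ _ beta_gt0 U_gtNy).
  rewrite integralZl// QE; over.
rewrite ge0_integralZr//; first last.
- by rewrite -QE integral_ge0// => q _; rewrite lee_fin.
- by apply/measurable_EFinP; exact: mkin.
rewrite integral_kinetic// -!EFinM; congr EFin.
rewrite -(pair_prod_bell fsym V_meas cluster_integrable lam0
  (fun l => cluster_gammaS U l lam0 vol0)).
(* The powers of h from the prefactor and of s from the momenta combine to lambda^(-3N). *)
rewrite -/Q sV lamE exprMn.
have f0 : (N`!)%:R != 0 :> R by rewrite pnatr_eq0 -lt0n fact_gt0.
have h0 : h ^+ (3 * N) != 0 by rewrite expf_neq0// gt_eqF.
have t0 : s ^+ (3 * N) != 0 by rewrite expf_neq0// gt_eqF.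
rewrite exprVn; move: (h ^+ _) (s ^+ _) (N`!)%:R h0 t0 f0 (Q) =>
  a b c a0 b0 c0 q.
by field; rewrite a0 b0 c0.
Qed.
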